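(* Consider unlimited backhaul capacity, where the energy efficiency at normalized cache capacity $\eta\in(0,1]$ is $$EE(\eta)=\frac{p_a\bar R_{\rm ca}}{p_aP_a+(1-p_a)P_i+w_{\rm ca}\eta N_fF-p_aw_{\rm bh}\frac{\ln\eta}{\ln N_f}\bar R_{\rm ca}},$$ and the energy efficiency without caching is $$EE_{\rm no}=\frac{p_a\bar R_{\rm ca}}{p_aP_a+(1-p_a)P_i+p_aw_{\rm bh}\bar R_{\rm ca}}.$$ Let $\eta_0=\frac{p_aw_{\rm bh}\bar R_{\rm ca}}{w_{\rm ca}F\,N_f\ln N_f}$ and suppose $\eta_0<1$. Then the gain of the maximal energy efficiency with caching over that without caching, $EE_{\rm gain}=\frac{\max_{\eta\in(0,1]}EE(\eta)}{EE_{\rm no}}$, equals $$EE_{\rm gain}=\frac{1}{1-G},\qquad G=\frac{\frac{1}{\ln N_f}\Big(\ln\frac{p_aw_{\rm bh}\bar R_{\rm ca}}{w_{\rm ca}F\ln N_f}-1\Big)}{\frac{p_aP_a+(1-p_a)P_i}{p_a\bar R_{\rm ca}w_{\rm bh}}+1}.$$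
   Context: $\eta=N_c/N_f$: each base station (BS) caches the $N_c$ most popular of $N_f\ge2$ contents, each of size $F>0$. The popularity skew parameter is $\delta=1$ and the cache hit ratio is approximated by $1+\ln\eta/\ln N_f$; without caching ($N_c=0$) the cache hit ratio is $0$. $p_a\in(0,1)$ is the probability that a BS is active; $P_a,P_i>0$ are the transmit-plus-circuit powers of a BS in active and idle mode; $w_{\rm ca},w_{\rm bh}>0$ are the power coefficients of cache and backhaul hardware; $\bar R_{\rm ca}>0$ is the average user rate, not depending on $\eta$. *)

(* Defs.v *)
From Stdlib Require Import Reals.
Open Scope R_scope.

Definition is_maximum (E : R -> Prop) (m : R) : Prop :=
  E m /\ is_upper_bound E m.

Section EnergyEfficiency.

(* p_a        : probability that a base station is active;
   P_a, P_i   : powers in active and idle mode;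
   w_ca, w_bh : power coefficients of cache and backhaul hardware;
   R_ca       : average user rate;
   F, N_f     : content size and number of contents. *)
Variables (p_a P_a P_i w_ca w_bh R_ca F : R) (N_f : nat).

(* With skew parameter 1 the cache hit ratio is approximated by
   1 + ln eta / ln N_f, so a fraction - ln eta / ln N_f of the traffic uses the
   backhaul. *)
Definition EE (eta : R) : R :=
  p_a * R_ca /
  (p_a * P_a + (1 - p_a) * P_i + w_ca * eta * INR N_f * F
   - p_a * w_bh * (ln eta / ln (INR N_f)) * R_ca).

(* Cache hit ratio 0: all of the traffic uses the backhaul. *)
Definition EE_no : R :=
  p_a * R_ca / (p_a * P_a + (1 - p_a) * P_i + p_a * w_bh * R_ca).

Definition eta0 : R :=
  p_a * w_bh * R_ca / (w_ca * F * INR N_f * ln (INR N_f)).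

Definition EE_values (v : R) : Prop :=
  exists eta : R, 0 < eta <= 1 /\ v = EE eta.

(* The maximum is unique when it exists, so this determines g. *)
Definition is_EE_gain (g : R) : Prop :=
  exists m : R, is_maximum EE_values m /\ g = m / EE_no.

Definition G : R :=
  (1 / ln (INR N_f) * (ln (p_a * w_bh * R_ca / (w_ca * F * ln (INR N_f))) - 1))
  / ((p_a * P_a + (1 - p_a) * P_i) / (p_a * R_ca * w_bh) + 1).

End EnergyEfficiency.

(* Main.v *)
(** Up to the positive factor [p_a * R_ca], maximizing [EE] means minimizing a
    denominator [a + c * eta - b * ln eta], which by [ln x <= x - 1] applied to
    [x = eta / (b / c)] is minimal at [eta = b / c = eta0]. *)
Require Import Defs.
From Stdlib Require Import Reals Lra.
Open Scope R_scope.

(** The tangent bound [1 + t <= exp t] at [t = ln x]. *)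
Lemma ln_le_sub_1 (x : R) : 0 < x -> ln x <= x - 1.
Proof.
  intros hx; pose proof (exp_ineq1_le (ln x)) as h.
  rewrite exp_ln in h by assumption; lra.
Qed.

Lemma ln_nonpos (x : R) : 0 < x <= 1 -> ln x <= 0.
Proof. intros hx; pose proof (ln_le_sub_1 x); lra. Qed.

Lemma ln_div (x y : R) : 0 < x -> 0 < y -> ln (x / y) = ln x - ln y.
Proof.
  intros hx hy; unfold Rdiv.
  rewrite ln_mult, ln_Rinv by auto using Rinv_0_lt_compat; ring.
Qed.

Lemma linear_minus_ln_min (b c x : R) :
  0 < b -> 0 < c -> 0 < x -> c * (b / c) - b * ln (b / c) <= c * x - b * ln x.
Proof.
  intros hb hc hx.
  assert (h0 : 0 < b / c) by (apply Rdiv_lt_0_compat; assumption).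
  assert (hq : 0 < x / (b / c)) by (apply Rdiv_lt_0_compat; assumption).
  pose proof (Rmult_le_compat_l b _ _ (Rlt_le _ _ hb) (ln_le_sub_1 _ hq)) as h.
  rewrite ln_div in h by assumption.
  (* The constant [b] is written as [c * (b / c)], the linear term at the minimizer. *)
  replace (b * (x / (b / c) - 1)) with (c * x - c * (b / c)) in h
    by (field; lra).
  lra.
Qed.

Theorem corollary5
  (p_a P_a P_i w_ca w_bh R_ca F : R) (N_f : nat)
  (hN : (2 <= N_f)%nat) (hF : 0 < F)
  (hp : 0 < p_a < 1) (hPa : 0 < P_a) (hPi : 0 < P_i)
  (hca : 0 < w_ca) (hbh : 0 < w_bh) (hR : 0 < R_ca)
  (heta0 : eta0 p_a w_ca w_bh R_ca F N_f < 1) :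
  is_EE_gain p_a P_a P_i w_ca w_bh R_ca F N_f
    (1 / (1 - G p_a P_a P_i w_ca w_bh R_ca F N_f)).
Proof.
  unfold is_EE_gain, is_maximum, is_upper_bound, EE_values, EE, EE_no, G.
  unfold eta0 in heta0.
  apply le_INR in hN; simpl in hN.
  set (N := INR N_f) in *.
  assert (hL : 0 < ln N) by (rewrite <- ln_1; apply ln_increasing; lra).
  set (L := ln N) in *.
  assert (hA : 0 < p_a * P_a + (1 - p_a) * P_i)
    by (apply Rplus_lt_0_compat; apply Rmult_lt_0_compat; lra).
  set (A := p_a * P_a + (1 - p_a) * P_i) in *.
  assert (hpR : 0 < p_a * R_ca) by (apply Rmult_lt_0_compat; lra).
  assert (hB : 0 < p_a * w_bh * R_ca)
    by (repeat apply Rmult_lt_0_compat; lra).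
  (* The coefficients of [- ln eta] and of [eta] in the denominator of [EE]; their quotient is
     [eta0]. *)
  set (b := p_a * w_bh * R_ca / L).
  set (c := w_ca * N * F).
  assert (hb : 0 < b) by (apply Rdiv_lt_0_compat; assumption).
  assert (hc : 0 < c) by (repeat apply Rmult_lt_0_compat; lra).
  assert (hbc : 0 < b / c) by (apply Rdiv_lt_0_compat; assumption).
  assert (heta : p_a * w_bh * R_ca / (w_ca * F * N * L) = b / c)
    by (unfold b, c; field; repeat split; lra).
  rewrite heta in heta0.
  assert (hden : forall x,
    A + w_ca * x * N * F - p_a * w_bh * (ln x / L) * R_ca
    = A + (c * x - b * ln x)) by (intro x; unfold b, c; field; lra).
  (* On this interval [- b * ln x] is nonnegative, so every term helps; positivity makes inversion
     reverse the order. *)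
  assert (hpos : forall x, 0 < x <= 1 -> 0 < A + (c * x - b * ln x)).
  { intros x hx.
    pose proof (Rmult_lt_0_compat c x hc (proj1 hx)).
    pose proof (Rmult_le_compat_l b _ _ (Rlt_le _ _ hb) (ln_nonpos x hx)).
    lra. }
  (* Here [eta0 < 1] makes the unconstrained minimizer admissible. *)
  assert (h01 : 0 < b / c <= 1) by lra.
  exists (p_a * R_ca / (A + (c * (b / c) - b * ln (b / c)))).
  split; [split |].
  - exists (b / c); split; [exact h01 | now rewrite hden].
  - intros v [x [hx ->]]; rewrite hden.
    apply Rmult_le_compat_l; [lra |].
    apply Rinv_le_contravar; [now apply hpos |].
    apply Rplus_le_compat_l, linear_minus_ln_min; lra.
  - pose proof (hpos _ h01) as hmin.
    (* The argument of the logarithm in [G]: it is [N * (b / c)], whence [ln (b / c) = ln K - L]. *)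
    set (K := p_a * w_bh * R_ca / (w_ca * F * L)).
    assert (hK : 0 < K)
      by (apply Rdiv_lt_0_compat; [| repeat apply Rmult_lt_0_compat]; lra).
    assert (hln : ln (b / c) = ln K - L).
    { unfold L; rewrite <- ln_div by lra; f_equal.
      unfold K, b, c; field; repeat split; lra. }
    (* Uses [c * (b / c) = b] and [b * L = p_a * w_bh * R_ca]. Rewriting [hmin] as well keeps the
       positivity of the minimal denominator in the new form. *)
    replace (c * (b / c) - b * ln (b / c))
      with (p_a * w_bh * R_ca - b * (ln K - 1)) in *
      by (rewrite hln; unfold b; field; lra).
    (* With [G] over the denominator of [EE_no], [1 - G] is the minimal denominator divided by that
       of [EE_no], hence nonzero by [hmin]. *)
    replace (1 / L * (ln K - 1) / (A / (p_a * R_ca * w_bh) + 1))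
      with (b * (ln K - 1) / (A + p_a * w_bh * R_ca))
      by (unfold b; field; repeat split; lra).
    field; repeat split; lra.
Qed.
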